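(* If $A$ is a good pseudo-hoop, then a subset $F\subseteq A$ is a fantastic filter of $A$ if and only if it is an involutive filter of $A$.
   Context: A pseudo-hoop is an algebra $(A,\odot,\rightarrow,\rightsquigarrow,1)$ of type $(2,2,2,0)$ such that for all $x,y,z\in A$: $x\odot 1=1\odot x=x$; $x\rightarrow x=x\rightsquigarrow x=1$; $(x\odot y)\rightarrow z=x\rightarrow(y\rightarrow z)$; $(x\odot y)\rightsquigarrow z=y\rightsquigarrow(x\rightsquigarrow z)$; $(x\rightarrow y)\odot x=(y\rightarrow x)\odot y=x\odot(x\rightsquigarrow y)=y\odot(y\rightsquigarrow x)$. The order is $x\le y$ iff $x\rightarrow y=1$. It is bounded if it has a least element $0$; then $x^-=x\rightarrow 0$, $x^\sim=x\rightsquigarrow 0$, $x^{-\sim}=(x^-)^\sim$, $x^{\sim-}=(x^\sim)^-$; it is good if $x^{-\sim}=x^{\sim-}$ for all $x$. Put $x\vee_1 y=(x\rightarrow y)\rightsquigarrow y$, $x\vee_2 y=(x\rightsquigarrow y)\rightarrow y$. A filter is a nonempty $F\subseteq A$ closed under $\odot$ and upward closed. A filter $F$ is involutive if $x^{-\sim}\rightarrow x\in F$ and $x^{\sim-}\rightsquigarrow x\in F$ for all $x$; it is fantastic if for all $x,y$: $y\rightarrow x\in F$ implies $x\vee_1 y\rightarrow x\in F$, and $y\rightsquigarrow x\in F$ implies $x\vee_2 y\rightsquigarrow x\in F$. *)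

(* Defs.v *)
From HB Require Import structures.
From mathcomp Require Import all_boot.
From mathcomp Require Import classical_sets.

Set Implicit Arguments.
Unset Strict Implicit.
Unset Printing Implicit Defensive.

Declare Scope hoop_scope.
Delimit Scope hoop_scope with hoop.
Local Open Scope classical_set_scope.
Local Open Scope hoop_scope.

Reserved Notation "x ⊙ y" (at level 40, left associativity).
Reserved Notation "x ⟶ y" (at level 55, right associativity).
Reserved Notation "x ⇝ y" (at level 55, right associativity).

HB.mixin Record isPseudoHoop (A : Type) := {
  hmul : A -> A -> A;
  himp : A -> A -> A;
  hrimp : A -> A -> A;
  hone : A;
  hmulx1 : forall x, hmul x hone = x;
  hmul1x : forall x, hmul hone x = x;
  himpxx : forall x, himp x x = hone;
  hrimpxx : forall x, hrimp x x = hone;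
  himp_mul : forall x y z, himp (hmul x y) z = himp x (himp y z);
  hrimp_mul : forall x y z, hrimp (hmul x y) z = hrimp y (hrimp x z);
  hdivC : forall x y, hmul (himp x y) x = hmul (himp y x) y;
  hdiv_rdiv : forall x y, hmul (himp y x) y = hmul x (hrimp x y);
  hrdivC : forall x y, hmul x (hrimp x y) = hmul y (hrimp y x)
}.

#[short(type="pseudoHoopType")]
HB.structure Definition PseudoHoop := { A of isPseudoHoop A }.

Notation "x ⊙ y" := (hmul x y) : hoop_scope.
Notation "x ⟶ y" := (himp x y) : hoop_scope.
Notation "x ⇝ y" := (hrimp x y) : hoop_scope.

Definition hle (A : pseudoHoopType) (x y : A) : Prop := x ⟶ y = hone.

HB.mixin Record PseudoHoop_isBounded A of PseudoHoop A := {
  hzero : A;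
  hle0x : forall x : A, hle hzero x
}.

#[short(type="bPseudoHoopType")]
HB.structure Definition BPseudoHoop :=
  { A of PseudoHoop_isBounded A & PseudoHoop A }.

(* hneg x is x^- and hrneg x is x^~; so x^{-~} = (x^-)^~ is hrneg (hneg x). *)
Definition hneg (A : bPseudoHoopType) (x : A) : A := x ⟶ hzero.
Definition hrneg (A : bPseudoHoopType) (x : A) : A := x ⇝ hzero.

Definition good (A : bPseudoHoopType) : Prop :=
  forall x : A, hrneg (hneg x) = hneg (hrneg x).

Definition hjoin1 (A : pseudoHoopType) (x y : A) : A := (x ⟶ y) ⇝ y.
Definition hjoin2 (A : pseudoHoopType) (x y : A) : A := (x ⇝ y) ⟶ y.

Definition hoop_filter (A : pseudoHoopType) (F : set A) : Prop :=
  [/\ F !=set0,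
      forall x y, F x -> F y -> F (x ⊙ y) &
      forall x y, F x -> hle x y -> F y].

Definition involutive_filter (A : bPseudoHoopType) (F : set A) : Prop :=
  hoop_filter F /\
  forall x, F (hrneg (hneg x) ⟶ x) /\ F (hneg (hrneg x) ⇝ x).

Definition fantastic_filter (A : pseudoHoopType) (F : set A) : Prop :=
  hoop_filter F /\
  forall x y,
    (F (y ⟶ x) -> F (hjoin1 x y ⟶ x)) /\
    (F (y ⇝ x) -> F (hjoin2 x y ⇝ x)).

(* Main.v *)
(** The double negation x'' = x^{-~} = x^{~-} of a good pseudo-hoop has the
    Glivenko property x → y'' ≤ (x → y)'': the element q = y'' → y satisfies
    q^~ = 0, since q^~ ≤ y'' and divisibility give
    q^~ = y'' ⊙ (y'' ⇝ q^~) = y'' ⊙ y^~ = 0.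
    Consequently x^- ⊙ (y → x) ≤ x^- ∧ y^- = y^- ⊙ (x → y'')
    is annihilated on the right by x ∨₁ y, that is y → x ≤ x ∨₁ y → x'', and
    x'' → x ∈ F then gives one half of fantasticity.  The other half is the
    same statement in the opposite pseudo-hoop.  Conversely, involutivity is
    fantasticity at y = 0. *)
Require Import Defs.
From HB Require Import structures.
From mathcomp Require Import all_boot.
From mathcomp Require Import classical_sets.

Set Implicit Arguments.
Unset Strict Implicit.
Unset Printing Implicit Defensive.

Local Open Scope hoop_scope.

(** An alias, so that the same carrier can bear a second structure: reversed product, exchanged
    arrows. *)
Definition opposite (A : Type) : Type := A.

Section OppositePseudoHoop.
Variable A : pseudoHoopType.

Fact opposite_hdivC (x y : A) : x ⊙ (x ⇝ y) = y ⊙ (y ⇝ x).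
Proof. exact: hrdivC. Qed.

Fact opposite_hdiv_rdiv (x y : A) : y ⊙ (y ⇝ x) = (x ⟶ y) ⊙ x.
Proof. by rewrite hdivC hdiv_rdiv hrdivC. Qed.

HB.instance Definition _ := isPseudoHoop.Build (opposite A)
  (fun x => hmul1x (x : A)) (fun x => hmulx1 (x : A))
  (fun x => hrimpxx (x : A)) (fun x => himpxx (x : A))
  (fun x y z => hrimp_mul (y : A) x z) (fun x y z => himp_mul (y : A) x z)
  opposite_hdivC opposite_hdiv_rdiv (fun x y => hdivC (x : A) y).

End OppositePseudoHoop.

Section PseudoHoopTheory.
Variable A : pseudoHoopType.
Implicit Types x y z : A.

Lemma hle_refl x : hle x x.
Proof. exact: himpxx. Qed.

Lemma hle_anti x y : hle x y -> hle y x -> x = y.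
Proof. by move=> xy yx; have := hdivC x y; rewrite xy yx !hmul1x. Qed.

Lemma himp1x x : hone ⟶ x = x.
Proof.
have shift y z : y ⟶ (hone ⟶ z) = y ⟶ z by rewrite -himp_mul hmulx1.
apply: hle_anti; last by rewrite /hle shift himpxx.
by rewrite /hle -(shift (hone ⟶ x) x) himpxx.
Qed.

Lemma himpx1 x : x ⟶ hone = hone.
Proof.
have absorb : (x ⟶ hone) ⊙ x = x by rewrite hdivC himp1x hmulx1.
(* Expanding only the antecedent turns the left side into [(x ⟶ hone) ⟶ (x ⟶ hone)]. *)
by rewrite -{1}absorb himp_mul himpxx.
Qed.

(** Both products have the same implication into every [w], so antisymmetry identifies them. *)
Lemma hmulA x y z : (x ⊙ y) ⊙ z = x ⊙ (y ⊙ z).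
Proof. have assoc w : (x ⊙ y) ⊙ z ⟶ w = x ⊙ (y ⊙ z) ⟶ w by rewrite !himp_mul.
by apply: hle_anti; [rewrite /hle assoc | rewrite /hle -assoc]; exact: himpxx. Qed.

Lemma hle_trans y x z : hle x y -> hle y z -> hle x z.
Proof.
move=> xy yz; have -> : x = (y ⟶ x) ⊙ y by rewrite -hdivC xy hmul1x.
by rewrite /hle himp_mul yz himpx1.
Qed.

Lemma hle_mull x y : hle (x ⊙ y) y.
Proof. by rewrite /hle himp_mul himpxx himpx1. Qed.

Lemma hle_imp x y z : hle (x ⊙ y) z <-> hle x (y ⟶ z).
Proof. by rewrite /hle himp_mul. Qed.

Lemma himp_mulK x y : hle ((x ⟶ y) ⊙ x) y.
Proof. by rewrite hle_imp; exact: hle_refl. Qed.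

Lemma hle_mul2r z x y : hle x y -> hle (x ⊙ z) (y ⊙ z).
Proof.
by move=> xy; rewrite hle_imp; apply: hle_trans xy _; rewrite -hle_imp; apply: hle_refl.
Qed.

End PseudoHoopTheory.

Section LeftRight.
Variable A : pseudoHoopType.
Implicit Types x y z : A.

Lemma hrimpx1 x : x ⇝ hone = hone.
Proof. exact: (@himpx1 (opposite A)). Qed.

Lemma hle_oppositeW x y : hle x y -> x ⇝ y = hone.
Proof.
move=> xy; have -> : x = y ⊙ (y ⇝ x) by rewrite -hdiv_rdiv xy hmul1x.
by rewrite hrimp_mul hrimpxx hrimpx1.
Qed.

End LeftRight.

(** Since both arrows define one order, inequalities transfer between [A] and its opposite. *)
Lemma hle_opposite (A : pseudoHoopType) (x y : A) :
  hle (A := opposite A) x y <-> hle x y.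
Proof.
by split; [exact: (@hle_oppositeW (opposite A)) | exact: hle_oppositeW].
Qed.

Section Residuation.
Variable A : pseudoHoopType.
Implicit Types x y z : A.

Lemma hle_rimp x y z : hle (x ⊙ y) z <-> hle y (x ⇝ z).
Proof. by rewrite -!(@hle_opposite A); exact: (@hle_imp (opposite A)). Qed.

Lemma hrimp_mulK x y : hle (x ⊙ (x ⇝ y)) y.
Proof. by rewrite hle_rimp; exact: hle_refl. Qed.

Lemma hle_mulr x y : hle (x ⊙ y) x.
Proof. by rewrite -hle_opposite; exact: (@hle_mull (opposite A)). Qed.

Lemma hle_mul2l z x y : hle x y -> hle (z ⊙ x) (z ⊙ y).
Proof. by rewrite -!(@hle_opposite A); exact: (@hle_mul2r (opposite A)). Qed.

Lemma hle_imp2l z x y : hle x y -> hle (z ⟶ x) (z ⟶ y).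
Proof. by move=> xy; rewrite -hle_imp; apply: hle_trans xy; apply: himp_mulK. Qed.

(** By divisibility [x ⊙ (x ⇝ y)] is the meet of [x] and [y]; this is its universal property. *)
Lemma hle_meetl x y z : hle z x -> hle z y -> hle z (x ⊙ (x ⇝ y)).
Proof.
move=> zx zy; have zE : z = x ⊙ (x ⇝ z) by rewrite -hdiv_rdiv zx hmul1x.
by rewrite [z]zE; apply/hle_mul2l/hle_rimp; rewrite -zE.
Qed.

Lemma hle_imp_comp x y z : hle ((y ⟶ z) ⊙ (x ⟶ y)) (x ⟶ z).
Proof.
rewrite -hle_imp hmulA; apply: hle_trans (himp_mulK y z).
exact/hle_mul2l/himp_mulK.
Qed.

End Residuation.

Fact opposite_hle0x (A : bPseudoHoopType) (x : A) :
  hle (A := opposite A) (hzero : A) x.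
Proof. by rewrite hle_opposite; exact: hle0x. Qed.

HB.instance Definition _ (A : bPseudoHoopType) :=
  PseudoHoop_isBounded.Build (opposite A) (@opposite_hle0x A).

Section BoundedTheory.
Variable A : bPseudoHoopType.
Implicit Types x y z : A.

Lemma hle_neg x y : hle (x ⊙ y) hzero <-> hle x (hneg y).
Proof. exact: hle_imp. Qed.

Lemma hle_rneg x y : hle (x ⊙ y) hzero <-> hle y (hrneg x).
Proof. exact: hle_rimp. Qed.

Lemma hneg_mul x : hle (hneg x ⊙ x) hzero.
Proof. exact: himp_mulK. Qed.

Lemma hmul_rneg x : hle (x ⊙ hrneg x) hzero.
Proof. exact: hrimp_mulK. Qed.

Lemma hle_rneg_neg x : hle x (hrneg (hneg x)).
Proof. by rewrite -hle_rneg; exact: hneg_mul. Qed.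

Lemma hneg_rneg_neg x : hneg (hrneg (hneg x)) = hneg x.
Proof.
apply: hle_anti; last by rewrite -hle_neg; exact: hmul_rneg.
rewrite -hle_neg; apply: hle_trans (hneg_mul (hrneg (hneg x))).
exact/hle_mul2l/hle_rneg_neg.
Qed.

Hypothesis goodA : good A.

Lemma hrneg_imp_eq0 x : hle (hrneg (hrneg (hneg x) ⟶ x)) hzero.
Proof.
set xx := hrneg (hneg x); set q := xx ⟶ x.
have qxx : q ⊙ xx = x by rewrite hdivC (hle_rneg_neg x : _ = _) hmul1x.
(* [hneg x] equals [hneg xx], that is [xx ⟶ hzero], and implication is monotone in its
   consequent. *)
have le_q : hle (hneg x) q.
  by rewrite -hneg_rneg_neg; apply/hle_imp2l/hle0x.
have le_xx : hle (hrneg q) xx.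
  by rewrite -hle_rneg; apply: hle_trans (hmul_rneg q); apply: hle_mul2r.
apply: hle_trans (hle_meetl le_xx (hle_refl _)) _.
(* By [qxx], [xx ⇝ hrneg q] is [hrneg x]; goodness reads the outer [xx] as [hneg (hrneg x)], which
   annihilates it. *)
by rewrite /(hrneg q) -hrimp_mul qxx {1}/xx goodA; exact: hneg_mul.
Qed.

(** With q = y'' → y, composition gives q ⊙ (x → y'') ≤ x → y. Hence (x → y'') ⊙ (x → y)^~ lies
    below q^~ = 0. *)
Lemma glivenko x y : hle (x ⟶ hrneg (hneg y)) (hrneg (hneg (x ⟶ y))).
Proof.
rewrite (goodA (x ⟶ y)) -hle_neg; apply: hle_trans (hrneg_imp_eq0 y).
rewrite -hle_rneg -hmulA; apply: hle_trans (hmul_rneg (x ⟶ y)).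
exact/hle_mul2r/hle_imp_comp.
Qed.

(** [x] annihilates [y ⊙ hrneg z] from the left, so this product is below [hrneg x], which x'' =
    x^{~-} annihilates. *)
Lemma rneg_neg_mul_le x y z :
  hle (x ⊙ y) z -> hle (hrneg (hneg x) ⊙ y) (hrneg (hneg z)).
Proof.
move=> xyz; rewrite !goodA -hle_neg hmulA.
apply: hle_trans (hneg_mul (hrneg x)).
apply: hle_mul2l; rewrite -hle_rneg -hmulA.
by apply: hle_trans (hmul_rneg z); exact: hle_mul2r.
Qed.

Lemma himp_le_hjoin1_imp x y : hle (y ⟶ x) (hjoin1 x y ⟶ hrneg (hneg x)).
Proof.
set w := x ⟶ hrneg (hneg y).
(* Contraposition: it makes [hneg y ⊙ w] the meet of [hneg y] and [hneg x]. *)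
have wE : w = hneg y ⇝ hneg x.
  apply: hle_anti.
    rewrite -hle_rimp -hle_neg hmulA; apply: hle_trans (hmul_rneg (hneg y)).
    exact/hle_mul2l/himp_mulK.
  rewrite -hle_imp -hle_rneg -hmulA; apply: hle_trans (hneg_mul x).
  exact/hle_mul2r/hrimp_mulK.
have meet : hle (hneg x ⊙ (y ⟶ x)) (hneg y ⊙ w).
  rewrite wE; apply: hle_meetl; last exact: hle_mulr.
  rewrite -hle_neg hmulA; apply: hle_trans (hneg_mul x).
  exact/hle_mul2l/himp_mulK.
(* The Glivenko property replaces [w] by (x → y)'', and [(x ⟶ y) ⊙ hjoin1 x y] is below [y]. *)
have w_join : hle (w ⊙ hjoin1 x y) (hrneg (hneg y)).
  apply: hle_trans (hle_mul2r _ (glivenko x y)) _.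
  exact/rneg_neg_mul_le/hrimp_mulK.
rewrite -hle_imp -hle_rneg -hmulA; apply: hle_trans (hle_mul2r _ meet) _.
rewrite hmulA; apply: hle_trans (hmul_rneg (hneg y)).
exact: hle_mul2l.
Qed.

Lemma involutive_hjoin1 (F : set A) (x y : A) : hoop_filter F ->
  F (hrneg (hneg x) ⟶ x) -> F (y ⟶ x) -> F (hjoin1 x y ⟶ x).
Proof.
case=> _ Fmul Fle Fx Fyx; apply: (Fle) (hle_imp_comp _ _ _).
exact: Fmul Fx (Fle _ _ Fyx (himp_le_hjoin1_imp x y)).
Qed.

End BoundedTheory.

Lemma good_opposite (A : bPseudoHoopType) : good A -> good (opposite A).
Proof. by move=> goodA x; exact/esym/goodA. Qed.

Lemma hoop_filter_opposite (A : pseudoHoopType) (F : set A) :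
  hoop_filter F -> hoop_filter (A := opposite A) F.
Proof.
case=> F0 Fmul Fle; split=> // x y Fx; first by move=> Fy; exact: Fmul.
by rewrite hle_opposite; exact: Fle.
Qed.

Theorem theorem4p22 (A : bPseudoHoopType) (goodA : good A) (F : set A) :
  fantastic_filter F <-> involutive_filter F.
Proof.
split=> -[filtF FP].
  split=> // x; have [[a Fa] _ Fle] := filtF.
  have F1 : F hone by apply: Fle Fa _; exact: himpx1.
  (* [hjoin1 x hzero] unfolds to [hrneg (hneg x)], and the premise [hzero ⟶ x] is [hone]. *)
  have [F1x F2x] := FP x hzero; split; first by apply: F1x; rewrite hle0x.
  by apply: F2x; rewrite (hle_oppositeW (hle0x x)).
split=> // x y; have [Fx1 Fx2] := FP x; split; first exact: involutive_hjoin1.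
(* In [opposite A], [hjoin1] is the [hjoin2] of [A] and [hrneg (hneg x)] is its [hneg (hrneg x)]. *)
apply: (@involutive_hjoin1 (opposite A)) Fx2; first exact: good_opposite.
exact: hoop_filter_opposite.
Qed.
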